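(* Assume that $\{a\}\in\mathcal A$ for all $a\in I$, and that for every $a\in I$ the price process $S^a$ is progressively measurable (with respect to $\mathfrak G$) and has a last element $S^a_\infty$ that is $\mathcal G_\infty$-measurable. Let ${\bm\pi}=(\pi^a)_{a\in I}$ be a family of continuous order execution delays such that the delay information $\mathfrak I^a$ of $\pi^a$ satisfies $\mathfrak I^a\subseteq\mathfrak F^A$ whenever $a\in A$, for all $A\in\mathcal A$. Moreover, assume that for every $A\in\mathcal A$ the trading filtration $\mathfrak F^A$ is right-continuous. Define $\tilde{\mathfrak F}=(\tilde{\mathfrak F}^A)_{A\in\mathcal A}$ by $$\tilde{\mathfrak F}^A=(\tilde{\mathcal F}^A_t)_{t\in[0,T]},\qquad \tilde{\mathcal F}^A_t:=\sigma\Big(\bigcup_{a\in A}\mathcal F^A_{\pi^a(t)}\Big),\qquad A\in\mathcal A.$$ Then the information in the market $((S^{a,{\bm\pi}})_{a\in I},\mathfrak F,\mathfrak G^{\bm\pi},T)$ can be represented via an information delay on the market $((S^{a,{\bm\pi}})_{a\in I},\tilde{\mathfrak F},\mathfrak G^{\bm\pi},T)$; that is, there is a family ${\bm\delta}=(\delta^A)_{A\in\mathcal A}$ of information delays, with delay informations contained in $\tilde{\mathfrak F}^A$ for each $A\in\mathcal A$, such that $\tilde{\mathcal F}^{A,{\bm\delta}}_t=\mathcal F^A_t$ for all $A\in\mathcal A$ and $t\in[0,T]$.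
   Context: **Setting.** Let $T\in(0,\infty]$ and let $(\Omega,\mathcal G,\mathfrak G,\mathbb P)$ be a filtered probability space with $\mathfrak G=(\mathcal G_t)$ indexed by $\mathbb R_+\cup\{\infty\}$, $\mathcal G=\mathcal G_\infty$. Let $I$ be an arbitrary set and, for $a\in I$, let $S^a$ be a real-valued $\mathfrak G$-adapted process indexed by $\mathbb R_+\cup\{\infty\}$. For each finite $A\subseteq I$ let $\mathfrak F^A=(\mathcal F^A_t)$ be a filtration (indexed by $\mathbb R_+\cup\{\infty\}$) with $\mathfrak F^A\subseteq\mathfrak G$ (inclusion of filtrations means inclusion at every time). An index system is a sequence $(\mathcal A^n)_{n\in\mathbb N}$, with $\mathcal A=\bigcup_n\mathcal A^n$, such that (i) $\mathcal A^n\subseteq\{A\subseteq I:|A|=n\}$; (ii) $A_1,A_2\in\mathcal A$ implies $A_1\cup A_2\in\mathcal A$; (iii) $A_1\subseteq A_2$ in $\mathcal A$ implies $\mathfrak F^{A_1}\subseteq\mathfrak F^{A_2}$. Such an index system is fixed. A market is a bundle of price processes, trading filtrations indexed by $\mathcal A$, a general filtration containing them, and a time horizon. For a stopping time $\tau$ of a filtration, the subscript $\tau$ denotes the $\sigma$-field of the $\tau$-past. **Order execution delay.** A pair $(\mathfrak I,\pi)$, with $\mathfrak I=(\mathcal I_t)_{t\in\mathbb R_+}\subseteq\mathfrak G$ a filtration (the delay information) and $\pi=(\pi(t))_{t\in[0,T]}$ a real-valued process, is an order execution delay if (i) each $\pi(t)$ is an $\mathfrak I$-stopping time; (ii) $t\le\pi(t)$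 for all $t\in[0,T]$; (iii) $\pi(t)\le\pi(u)$ for all $0\le t\le u\le T$. It is continuous if all paths $t\mapsto\pi(t)$ are continuous. For a family ${\bm\pi}=(\pi^a)_{a\in I}$, $S^{a,{\bm\pi}}_t:=S^a_{\pi^a(t)}$ for $t\in[0,T]$, and $\mathfrak G^{\bm\pi}=(\mathcal G^{\bm\pi}_t)_{t\in[0,T]}$ with $\mathcal G^{\bm\pi}_t=\sigma\big(\bigcup_{a\in I}\mathcal G_{\pi^a(t)}\big)$. **Information delay.** On a market with general filtration $\mathfrak K$ and trading filtrations $\tilde{\mathfrak F}^A\subseteq\mathfrak K$ on $[0,T]$, a pair $(\mathfrak H,\delta)$, with $\mathfrak H=(\mathcal H_t)_{t\in[0,T]}\subseteq\mathfrak K$ a filtration (the delay information) and $(\delta(t))_{t\in[0,T]}$ a real-valued process, is an information delay if (i) each $\delta(t)$ is an $\mathfrak H$-stopping time; (ii) $0\le\delta(t)\le t$ for all $t\in[0,T]$; (iii) $\delta(t,\omega)\le\delta(s,\omega)$ for all $0\le t\le s\le T$, $\omega\in\Omega$. If $\mathfrak H\subseteq\tilde{\mathfrak F}^A$, put $\tilde{\mathcal F}^{A,\delta}_t:=\tilde{\mathcal F}^A_{\delta(t)}$. For a family ${\bm\delta}=(\delta^A)_{A\in\mathcal A}$ of information delays with delay informations $\mathfrak H^A\subseteq\tilde{\mathfrak F}^A$, the delayed filtrations are defined recursively (over $|A|$) by $$\tilde{\mathcal F}^{A,{\bm\delta}}_t=\sigma\Big(\tilde{\mathcal F}^{A,\delta^A}_t\cup\bigcup_{A'\in\mathcal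 A,\,A'\subsetneq A}\tilde{\mathcal F}^{A',{\bm\delta}}_t\Big).$$
   Formalization: Added assumption: for every A in 𝒜, the σ-field F̃^A_0 = σ(∪_{a∈A} F^A_{π^a(0)}) is contained in F^A_0. Without it the claim fails (π(t)=t+1, F^A trivial before time 1, full after), and the conclusion at t=0 forces it. *)

(* Defs.v *)
From HB Require Import structures.
From mathcomp Require Import all_boot all_order all_algebra finmap.
From mathcomp Require Import all_classical all_reals all_analysis.

Set Implicit Arguments.
Unset Strict Implicit.
Unset Printing Implicit Defensive.

Import Order.TTheory GRing.Theory Num.Theory.
Import numFieldNormedType.Exports.
Local Open Scope classical_set_scope.
Local Open Scope ring_scope.

(* Time is a subset of \bar R, so that [0, T] makes sense for T = +oo, in which
   case it contains +oo.  A family of set systems, filtration or process is a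
   total function of t : \bar R; only its values at the times of the index set
   at hand matter. *)

Section Filtrations.
Context {R : realType} {Omega : Type}.

Definition timeT (T : \bar R) : set (\bar R) := [set t | (0 <= t <= T)%E].
Definition time_fin : set (\bar R) := [set t | (0 <= t < +oo)%E].

Definition filtration (J : set (\bar R)) (F : \bar R -> set (set Omega)) :=
  (forall t, J t -> sigma_algebra setT (F t)) /\
  (forall s t, J s -> J t -> (s <= t)%E -> F s `<=` F t).

Definition subfiltration (J : set (\bar R)) (F G : \bar R -> set (set Omega)) :=
  forall t, J t -> F t `<=` G t.

Definition right_continuous_filtration (F : \bar R -> set (set Omega)) :=
  forall t, time_fin t ->
    F t = \bigcap_(s in [set s | (t < s < +oo)%E]) F s.

Definition stopping_time (J : set (\bar R)) (F : \bar R -> set (set Omega))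
    (tau : Omega -> \bar R) :=
  forall t, J t -> F t [set w | (tau w <= t)%E].

(* Sigma-field of the tau-past, for a filtration F indexed by [0, T] and a
   stopping time tau with values in [0, T]. *)
Definition past (T : \bar R) (F : \bar R -> set (set Omega))
    (tau : Omega -> \bar R) : set (set Omega) :=
  [set B | F T B /\
    forall t, timeT T t -> F t (B `&` [set w | (tau w <= t)%E])].

Definition adapted (J : set (\bar R)) (F : \bar R -> set (set Omega))
    (X : \bar R -> Omega -> R) :=
  forall t, J t -> forall B : set R, measurable B -> F t (X t @^-1` B).

(* For every real t >= 0, the map (s, w) |-> X s w on [0, t] x Omega is
   measurable for the product of the Borel sets of [0, t] and of F t. *)
Definition progressively_measurable (F : \bar R -> set (set Omega))
    (X : \bar R -> Omega -> R) :=
  forall t : R, 0 <= t -> forall B : set R, measurable B ->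
    <<s `[0, t] `*` [set: Omega],
        [set D | exists C E, [/\ measurable C, C `<=` `[0, t], F t%:E E
                               & D = C `*` E]] >>
      [set p : R * Omega | p.1 \in `[0, t] /\ B (X p.1%:E p.2)].

End Filtrations.

Section IndexSystem.
Context {R : realType} {Omega : Type} {I : choiceType}.

(* The sequence (A^n) is indexed by the integers n >= 1; its value at n = 0 is
   ignored.  The empty set is thus never an index. *)
Definition indices (An : nat -> set {fset I}) : set {fset I} :=
  \bigcup_(n in [set n | (0 < n)%N]) An n.

Definition index_system (F : {fset I} -> \bar R -> set (set Omega))
    (An : nat -> set {fset I}) :=
  [/\ forall n A, (0 < n)%N -> An n A -> #|` A|%fset = n,
      forall A1 A2, indices An A1 -> indices An A2 ->
        indices An (A1 `|` A2)%fset
    & forall A1 A2, indices An A1 -> indices An A2 -> (A1 `<=` A2)%fset ->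
        subfiltration (timeT +oo%E) (F A1) (F A2)].

End IndexSystem.

Section OrderExecutionDelay.
Context {R : realType} {Omega : Type}.

Definition order_execution_delay (T : \bar R)
    (G : \bar R -> set (set Omega)) (Inf : \bar R -> set (set Omega))
    (p : \bar R -> Omega -> \bar R) :=
  [/\ filtration time_fin Inf,
      subfiltration time_fin Inf G,
      forall t, timeT T t -> stopping_time time_fin Inf (p t),
      forall t w, timeT T t -> (t <= p t w)%E
    & forall t u w, timeT T t -> timeT T u -> (t <= u)%E ->
        (p t w <= p u w)%E].

Definition continuous_delay (T : \bar R) (p : \bar R -> Omega -> \bar R) :=
  forall w, {within timeT T, continuous (fun t => p t w)}.

Context {I : choiceType}.

Definition delayed_price (S : I -> \bar R -> Omega -> R)
    (p : I -> \bar R -> Omega -> \bar R) (a : I) (t : \bar R) (w : Omega) : R :=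
  S a (p a t w) w.

Definition delayed_general (G : \bar R -> set (set Omega))
    (p : I -> \bar R -> Omega -> \bar R) (t : \bar R) : set (set Omega) :=
  <<s \bigcup_(a in [set: I]) past +oo%E G (p a t) >>.

Definition execution_filtration (F : {fset I} -> \bar R -> set (set Omega))
    (p : I -> \bar R -> Omega -> \bar R) (A : {fset I}) (t : \bar R) :
    set (set Omega) :=
  <<s \bigcup_(a in [set a | a \in A]) past +oo%E (F A) (p a t) >>.

End OrderExecutionDelay.

Section Market.
Context {R : realType} {Omega : Type} {I : choiceType}.

Record market := Market {
  price : I -> \bar R -> Omega -> R;
  trading : {fset I} -> \bar R -> set (set Omega);
  general : \bar R -> set (set Omega);
  horizon : \bar R }.

Definition is_market (AA : set {fset I}) (M : market) :=
  [/\ filtration (timeT (horizon M)) (general M),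
      forall A, AA A -> filtration (timeT (horizon M)) (trading M A),
      forall A, AA A ->
        subfiltration (timeT (horizon M)) (trading M A) (general M)
    & forall a, adapted (timeT (horizon M)) (general M) (price M a)].

Definition information_delay (M : market) (H : \bar R -> set (set Omega))
    (delta : \bar R -> Omega -> \bar R) :=
  [/\ filtration (timeT (horizon M)) H,
      subfiltration (timeT (horizon M)) H (general M),
      forall t, timeT (horizon M) t ->
        stopping_time (timeT (horizon M)) H (delta t),
      forall t w, timeT (horizon M) t -> (0 <= delta t w <= t)%E
    & forall t s w, timeT (horizon M) t -> timeT (horizon M) s -> (t <= s)%E ->
        (delta t w <= delta s w)%E].

Fixpoint delayed_rec (AA : set {fset I}) (M : market)
    (delta : {fset I} -> \bar R -> Omega -> \bar R) (n : nat)
    (A : {fset I}) (t : \bar R) : set (set Omega) :=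
  <<s past (horizon M) (trading M A) (delta A t) `|`
      (if n is m.+1 then
         \bigcup_(A' in [set A' | AA A' /\ (A' `<` A)%fset])
           delayed_rec AA M delta m A' t
       else set0) >>.

(* Recursion over #|A|, which serves as fuel; the defining recursive equation is
   delayed_filtrationE. *)
Definition delayed_filtration (AA : set {fset I}) (M : market)
    (delta : {fset I} -> \bar R -> Omega -> \bar R) (A : {fset I}) :
    \bar R -> set (set Omega) :=
  delayed_rec AA M delta #|` A|%fset A.

Lemma delayed_rec_fuel AA M delta n A t : (#|` A|%fset <= n)%N ->
  delayed_rec AA M delta n A t = delayed_filtration AA M delta A t.
Proof.
rewrite /delayed_filtration.
have [k] := ubnP #|` A|%fset; elim: k A n => // k IH A n.
rewrite ltnS => Ak An.
have sub0 B : (B `<` A)%fset -> #|` A|%fset = 0%N -> False.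
  by move=> /fproper_ltn_card lt A0; rewrite A0 in lt.
case: n An => [|n] An; first by move: An; rewrite leqn0 => /eqP ->.
case E : #|` A|%fset => [|m] /=; congr (<<s _ `|` _ >>).
  by apply/seteqP; split => // x [B [_ BA] _]; case: (sub0 _ BA E).
apply: eq_bigcupr => B [_ /fproper_ltn_card BA].
rewrite !IH //.
- exact: leq_trans BA Ak.
- by rewrite -ltnS -E.
- exact: leq_trans BA Ak.
- by rewrite -ltnS; exact: leq_trans BA An.
Qed.

Lemma delayed_filtrationE AA M delta A t :
  delayed_filtration AA M delta A t =
  <<s past (horizon M) (trading M A) (delta A t) `|`
      \bigcup_(A' in [set A' | AA A' /\ (A' `<` A)%fset])
        delayed_filtration AA M delta A' t >>.
Proof.
rewrite -(@delayed_rec_fuel _ _ _ #|` A|%fset.+1) //=; congr (<<s _ `|` _ >>).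
apply: eq_bigcupr => B [_ /fproper_ltn_card BA].
by rewrite delayed_rec_fuel// ltnW.
Qed.

Definition represented_via_information_delay (AA : set {fset I})
    (M M' : market) :=
  exists (H : {fset I} -> \bar R -> set (set Omega))
         (delta : {fset I} -> \bar R -> Omega -> \bar R),
    (forall A, AA A ->
       information_delay M' (H A) (delta A) /\
       subfiltration (timeT (horizon M')) (H A) (trading M' A)) /\
    (forall A t, AA A -> timeT (horizon M') t ->
       delayed_filtration AA M' delta A t = trading M A t).

End Market.

(* Main.v *)
(* Write p^A(u) for the maximum of the delays p^a(u), a in A; it is continuous,
   nondecreasing and satisfies u <= p^A(u).  The information delay is its
   generalised inverse delta^A(t) = inf {u in [0, T] | t <= p^A(u)}, with the
   execution filtration F~^A itself as delay information.  By right-continuity,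
   delta^A(t) <= u iff t <= p^A(u), and this event lies in F~^A_u.

   A set B in F^A_t belongs to the delta^A(t)-past of F~^A because
   B /\ {t <= p^a(u)} is in F^A_{p^a(u)} for each a.  Conversely, if B is in that
   past and s > t, then B /\ {t <= p^A(u) <= s} is in F^A_s for every u, as
   F~^A_u is contained in F^A_{p^A(u)}.  On {p^A(0) <= s} the path of p^A meets
   [t, s] at 0, at T or at a rational time, so a countable union of these sets
   recovers B there; on {s < p^A(0)} one uses F~^A_0 <= F^A_0.  Letting s decrease
   to t, right-continuity of F^A gives B in F^A_t.  The recursion on subsets of A
   then adds nothing, since F^A' <= F^A for A' <= A. *)
Require Import Defs.
From mathcomp Require Import all_boot all_order all_algebra finmap.
From mathcomp Require Import all_classical all_reals all_analysis.
From mathcomp Require Import measurable_realfun.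
Set Implicit Arguments.
Unset Strict Implicit.
Unset Printing Implicit Defensive.
Import Order.TTheory GRing.Theory Num.Theory.
Import numFieldNormedType.Exports.
Local Open Scope classical_set_scope.
Local Open Scope ring_scope.

(** * Closure properties of a sigma-algebra given as a set of sets *)

Section SigmaAlgebra.
Context {Omega : pointedType} (G : set (set Omega)).
Hypothesis hG : sigma_algebra setT G.

(** Turns membership in a bare set system into measurability for a type carrying it, so that the
    closure rules for [measurable] apply. *)
Lemma sigma_algebra_measurableE (A : set Omega) :
  G A = measurable (A : set (g_sigma_algebraType G)).
Proof. by rewrite measurable_g_measurableTypeE. Qed.

Let gE := sigma_algebra_measurableE.

Lemma sigma_algebra_setT : G setT.
Proof. by rewrite gE; exact: measurableT. Qed.

Lemma sigma_algebra_setC A : G A -> G (~` A).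
Proof. by rewrite !gE; exact: measurableC. Qed.

Lemma sigma_algebra_setI A B : G A -> G B -> G (A `&` B).
Proof. by rewrite !gE; exact: measurableI. Qed.

Lemma sigma_algebra_setU A B : G A -> G B -> G (A `|` B).
Proof. by rewrite !gE; exact: measurableU. Qed.

Lemma sigma_algebra_bigcup_rat (A : rat -> set Omega) :
  (forall q, G (A q)) -> G (\bigcup_q A q).
Proof.
move=> GA; rewrite gE; apply: bigcupT_measurable_rat => q.
by rewrite -gE.
Qed.

Lemma sigma_algebra_bigcup_fset (I : choiceType) (D : {fset I})
    (A : I -> set Omega) :
  (forall i, i \in D -> G (A i)) -> G (\bigcup_(i in [set` D]) A i).
Proof.
move=> GA; rewrite gE; apply: fin_bigcup_measurable => [|i /= iD].
  exact: finite_fset.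
by rewrite -gE; exact: GA.
Qed.

End SigmaAlgebra.

(** * Continuous paths on [0, T] and rational times *)

Section Paths.
Context {R : realType}.
Implicit Types (T u s x y : \bar R) (f : \bar R -> \bar R).

Lemma rat_between_ereal x y : (x < y)%E ->
  exists q : rat, (x < (ratr q)%:E < y)%E.
Proof.
have rr (a b : R) : a < b -> exists q : rat, a < ratr q < b.
  by move=> /rat_in_itvoo[q]; rewrite in_itv /=; exists q.
case: x y => [a||] [b||] //=.
- by rewrite lte_fin => /rr.
- by move=> _; have [|q /andP[aq _]] := rr a (a + 1); rewrite ?ltrDl//;
    exists q; rewrite lte_fin aq ltry.
- by move=> _; have [|q /andP[_ aq]] := rr (b - 1) b; rewrite ?gtrBl//;
    exists q; rewrite lte_fin aq ltNyr.
- by move=> _; exists 0; rewrite ltry ltNyr.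
Qed.

(** The neighbourhood contains an interval with open ends around u, which leaves room to the right
    of u. The witness z is the right end of that interval cut at y, and any rational strictly
    between u and z works. *)
Lemma nbhs_rat_right (V : set (\bar R)) u y : nbhs u V -> (u < y)%E ->
  exists2 q : rat, (u < (ratr q)%:E < y)%E & V (ratr q)%:E.
Proof.
rewrite itv_nbhsE => -[[bl br] [iop ui] iV] uy.
have [z [uz zy zV]] : exists z, [/\ (u < z)%E, (z <= y)%E &
    forall q : \bar R, (u < q < z)%E -> V q].
  move: ui; rewrite itv_boundlr => /andP[blu ubr].
  have blq q : (u < q)%E -> (bl <= BLeft q)%O.
    by move=> uq; apply: le_trans blu _; rewrite bnd_simp ltW.
  case: br iop ubr iV => [[b|b]|[|]] iop ubr iV.
  - exists (Order.min b y); rewrite lt_min uy andbT ge_min lexx orbT.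
    split=> // q /andP[uq]; rewrite lt_min => /andP[qb _]; apply: iV => /=.
    by rewrite itv_boundlr blq// bnd_simp.
  - by move: iop; rewrite /itv_open_ends /=; case: (bl) => [[]|[]].
  - by move: ubr; rewrite bnd_simp.
  - exists y; split=> // q /andP[uq _]; apply: iV => /=.
    by rewrite itv_boundlr blq.
have [q /andP[uq qz]] := rat_between_ereal uz.
by exists q; [rewrite uq (lt_le_trans qz)|apply: zV; rewrite uq].
Qed.

Lemma nbhs_rat_left (V : set (\bar R)) u x : nbhs u V -> (x < u)%E ->
  exists2 q : rat, (x < (ratr q)%:E < u)%E & V (ratr q)%:E.
Proof.
rewrite itv_nbhsE => -[[bl br] [iop ui] iV] xu.
have [z [zu xz zV]] : exists z, [/\ (z < u)%E, (x <= z)%E &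
    forall q : \bar R, (z < q < u)%E -> V q].
  move: ui; rewrite itv_boundlr => /andP[blu ubr].
  have qbr q : (q < u)%E -> (BRight q <= br)%O.
    by move=> qu; apply: le_trans ubr; rewrite bnd_simp ltW.
  case: bl iop blu iV => [[b|b]|[|]] iop blu iV.
  - by move: iop; rewrite /itv_open_ends /=; case: (br) => [[]|[]].
  - exists (Order.max b x); rewrite gt_max xu andbT le_max lexx orbT.
    split=> // q /andP[]; rewrite gt_max => /andP[bq _] qu; apply: iV => /=.
    by rewrite itv_boundlr qbr// bnd_simp bq.
  - exists x; split=> // q /andP[_ qu]; apply: iV => /=.
    by rewrite itv_boundlr qbr.
  - by move: blu; rewrite bnd_simp.
have [q /andP[zq qu]] := rat_between_ereal zu.
by exists q; [rewrite (le_lt_trans xz)|apply: zV; rewrite zq].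
Qed.

Lemma continuous_lt_right T f u s : {within timeT T, continuous f} ->
  timeT T u -> (u < T)%E -> (f u < s)%E ->
  exists2 q : rat, (u < (ratr q)%:E < T)%E & (f (ratr q)%:E < s)%E.
Proof.
move=> cf Tu uT fus.
have := (cf u) _ (open_ereal_lt_ereal fus).
(* Continuity is relative to [0, T], so a nearby time can be used only if it lies in [0, T];
   choosing q below T ensures this. *)
rewrite /nbhs /= -nbhs_subspace_in// => /nbhs_rat_right/(_ uT)[q uqT].
have /andP[u0 _] := Tu; have /andP[uq qT] := uqT.
move=> fq; exists q => //; apply: fq.
by rewrite /timeT /= (le_trans u0 (ltW uq)) ltW.
Qed.

Lemma continuous_gt_left T f u s : {within timeT T, continuous f} ->
  timeT T u -> (0 < u)%E -> (s < f u)%E ->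
  exists2 q : rat, ((0 : \bar R) < (ratr q)%:E < u)%E & (s < f (ratr q)%:E)%E.
Proof.
move=> cf Tu uT fus.
have := (cf u) _ (open_ereal_gt_ereal fus).
rewrite /nbhs /= -nbhs_subspace_in// => /nbhs_rat_left/(_ uT)[q uqT].
have /andP[_ u0] := Tu; have /andP[uq qT] := uqT.
move=> fq; exists q => //; apply: fq.
by rewrite /timeT /= (le_trans (ltW qT) u0) ltW.
Qed.

End Paths.

(** * Stopping times, their pasts, and stopped processes *)

Section StoppingTimes.
Context {R : realType} {Omega : pointedType}.
Implicit Types (T t s : \bar R) (F G : \bar R -> set (set Omega)).
Implicit Types (tau sigma : Omega -> \bar R) (B : set Omega).

(** Delay informations stop short of time +oo, while the trading and general filtrations include it;
    at +oo the event to test is the whole space. *)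
Lemma stopping_time_extend F G tau : filtration (timeT +oo%E) G ->
  subfiltration time_fin F G -> stopping_time time_fin F tau ->
  stopping_time (timeT +oo%E) G tau.
Proof.
move=> [Gs _] FG Ftau t Jt; have /andP[t0 _] := Jt.
have [->|ty] := eqVneq t +oo%E.
  rewrite (_ : [set w | _] = setT); last first.
    by apply/seteqP; split=> // w _; exact: leey.
  by apply: sigma_algebra_setT; apply: Gs; rewrite /timeT /= le0y lexx.
have Jt' : time_fin t by rewrite /time_fin /= t0 ltey.
exact/FG/Ftau.
Qed.

Lemma past_sigma_algebra T F tau : (0 <= T)%E -> filtration (timeT T) F ->
  stopping_time (timeT T) F tau -> sigma_algebra setT (past T F tau).
Proof.
move=> T0 [Fs _] Ftau.
have TT : timeT T T by rewrite /timeT /= T0 lexx.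
split=> [|A [AT At]|A hA].
- split=> [|t Jt]; first by case: (Fs _ TT).
  by rewrite set0I; case: (Fs _ Jt).
- rewrite setTD; split=> [|t Jt]; first exact/(sigma_algebra_setC (Fs _ TT)).
  have -> : ~` A `&` [set w | (tau w <= t)%E] =
      [set w | (tau w <= t)%E] `&` ~` (A `&` [set w | (tau w <= t)%E]).
    by rewrite setCI setIUr setICr setU0 setIC.
  have := Fs _ Jt => Fst; apply: sigma_algebra_setI => //; first exact: Ftau.
  by apply: sigma_algebra_setC => //; exact: At.
- split=> [|t Jt].
    by have [_ _ FU] := Fs _ TT; apply: FU => n; case: (hA n).
  rewrite setI_bigcupl; have [_ _ FU] := Fs _ Jt; apply: FU => n.
  by case: (hA n) => _; exact.
Qed.

Lemma past_subfiltration T F G tau : (0 <= T)%E ->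
  subfiltration (timeT T) F G -> past T F tau `<=` past T G tau.
Proof.
move=> T0 FG B [BT Bt]; split=> [|t Jt]; last exact/FG/Bt.
by apply: FG BT; rewrite /timeT /= T0 lexx.
Qed.

Lemma past_le T F sigma tau : filtration (timeT T) F ->
  stopping_time (timeT T) F tau -> (forall w, sigma w <= tau w)%E ->
  past T F sigma `<=` past T F tau.
Proof.
move=> [Fs _] Ftau st B [BT Bt]; split=> // t Jt.
have -> : B `&` [set w | (tau w <= t)%E] =
    (B `&` [set w | (sigma w <= t)%E]) `&` [set w | (tau w <= t)%E].
  apply/seteqP; split=> w [/=]; last by move=> [? _].
  by move=> Bw tw; split=> //; split=> //; exact: le_trans tw.
by apply: (sigma_algebra_setI (Fs _ Jt)); [exact: Bt|exact: Ftau].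
Qed.

(** The complement {tau < t} is the union of the events {tau <= q} over rationals q < t, and each of
    these is known before t. *)
Lemma stopping_time_ge T F tau t : filtration (timeT T) F ->
  stopping_time (timeT T) F tau -> (forall w, 0 <= tau w)%E -> timeT T t ->
  F t [set w | (t <= tau w)%E].
Proof.
move=> [Fs Fm] Ftau tau0 Jt; have /andP[t0 tT] := Jt.
pose Q (q : rat) : set Omega :=
  [set w | (tau w <= (ratr q)%:E)%E /\ ((ratr q)%:E < t)%E].
have -> : [set w | (t <= tau w)%E] = ~` \bigcup_q Q q.
  apply/seteqP; split=> w /=.
    by move=> ttau [q _ [/= tq qt]]; have := lt_le_trans (le_lt_trans tq qt) ttau;
      rewrite ltxx.
  move=> nQ; rewrite leNgt; apply/negP => /rat_between_ereal[q /andP[tq qt]].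
  by apply: nQ; exists q => //; split=> //; exact: ltW.
apply: (sigma_algebra_setC (Fs _ Jt)).
apply: (sigma_algebra_bigcup_rat (Fs _ Jt)) => q.
(* A negative q is not a time of the filtration, but its event is empty since tau is nonnegative. *)
have [/andP[q0 qt]|nqt] := boolP ((0 : \bar R) <= (ratr q)%:E < t)%E.
  have Jq : timeT T (ratr q)%:E by rewrite /timeT /= q0 (le_trans (ltW qt)).
  rewrite (_ : Q q = [set w | (tau w <= (ratr q)%:E)%E]).
    by apply: (Fm _ _ Jq Jt (ltW qt)); exact: Ftau.
  by apply/seteqP; split=> w; [case|split].
rewrite (_ : Q q = set0); first by case: (Fs _ Jt).
rewrite -subset0 => w [tq qt]; move: nqt; rewrite qt andbT.
by rewrite (le_trans (tau0 w) tq).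
Qed.

(** Cutting the set with {tau <= s} leaves nothing when s < t, and an event of F_s when t <= s. *)
Lemma past_ge T F tau t B : filtration (timeT T) F ->
  stopping_time (timeT T) F tau -> (forall w, 0 <= tau w)%E -> timeT T t ->
  F t B -> past T F tau (B `&` [set w | (t <= tau w)%E]).
Proof.
move=> hF Ftau tau0 Jt FB; have [Fs Fm] := hF; have /andP[t0 tT] := Jt.
have FB' := sigma_algebra_setI (Fs _ Jt) FB (stopping_time_ge hF Ftau tau0 Jt).
have TT : timeT T T by rewrite /timeT /= lexx (le_trans t0).
split=> [|s Js]; first exact: Fm FB'.
have [ts|st] := leP t s.
  by apply: (sigma_algebra_setI (Fs _ Js)); [exact: Fm FB'|exact: Ftau].
rewrite (_ : _ `&` _ = set0); first by case: (Fs _ Js).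
rewrite -subset0 => w [[_ /= ttau] taus].
by have := lt_le_trans st (le_trans ttau taus); rewrite ltxx.
Qed.

Lemma past_initial T F tau t : filtration (timeT T) F ->
  stopping_time (timeT T) F tau -> timeT T t -> (forall w, t <= tau w)%E ->
  F t `<=` past T F tau.
Proof.
move=> hF Ftau Jt ttau B FB; have /andP[t0 _] := Jt.
rewrite -(setIT B) (_ : setT = [set w | (t <= tau w)%E]).
  by apply: past_ge => // w; exact: le_trans (ttau w).
by apply/seteqP; split=> w // _; exact: ttau.
Qed.

(** Truncation at s makes tau real-valued; it is the time coordinate along which progressive
    measurability is pulled back below. *)
Lemma measurable_stopped F tau (s : R) : 0 <= s ->
  filtration (timeT +oo%E) F -> stopping_time (timeT +oo%E) F tau ->
  (forall w, 0 <= tau w)%E -> forall C : set R, measurable C ->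
  F s%:E [set w | C (fine (mine (tau w) s%:E))].
Proof.
move=> s0 [Fs Fm] Ftau tau0 C mC.
have Js : timeT +oo%E s%:E by rewrite /timeT /= lee_fin s0 leey.
suff mf : measurable_fun setT
    ((fun w => mine (tau w) s%:E) : g_sigma_algebraType (F s%:E) -> \bar R).
  have := measurableT_comp (fine_measurable measurableT) mf.
  move=> /(_ measurableT _ mC).
  by rewrite setTI -sigma_algebra_measurableE//; exact: Fs.
apply: (measurability _ (ErealGenOInfty.measurableE R)) => _ [_ [r ->]] <-.
rewrite setTI -sigma_algebra_measurableE; last exact: Fs.
have [rs|sr] := ltP r s; last first.
  rewrite (_ : _ @^-1` _ = set0); first by case: (Fs _ Js).
  rewrite -subset0 => w /=; rewrite in_itv /= andbT lt_min => /andP[_].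
  by rewrite lte_fin ltNge sr.
have -> : (fun w => mine (tau w) s%:E) @^-1` `]r%:E, +oo[%classic =
    ~` [set w | (tau w <= r%:E)%E].
  apply/seteqP; split=> w /=; rewrite in_itv /= andbT lt_min lte_fin rs andbT.
    by move=> /lt_geF ->.
  by move=> /negP; rewrite -ltNge.
apply: (sigma_algebra_setC (Fs _ Js)).
have [r0|r0] := leP 0 r.
  have Jr : timeT +oo%E r%:E by rewrite /timeT /= lee_fin r0 leey.
  by apply: (Fm _ _ Jr Js); [rewrite lee_fin ltW|exact: Ftau].
rewrite (_ : [set w | _] = set0); first by case: (Fs _ Js).
rewrite -subset0 => w /= taur; have := le_trans (tau0 w) taur.
by rewrite lee_fin leNgt r0.
Qed.

(** On {tau <= s} the stopped value is X composed with w |-> (min(tau w, s), w), a measurable map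
    from (Omega, F_s) to [0, s] x Omega. *)
Lemma progressive_stopped F (X : \bar R -> Omega -> R) tau (s : R) : 0 <= s ->
  filtration (timeT +oo%E) F -> stopping_time (timeT +oo%E) F tau ->
  (forall w, 0 <= tau w)%E -> progressively_measurable F X ->
  forall B : set R, measurable B ->
  F s%:E [set w | (tau w <= s%:E)%E /\ B (X (tau w) w)].
Proof.
move=> s0 hF Ftau tau0 hX B mB; have [Fs _] := hF.
have Js : timeT +oo%E s%:E by rewrite /timeT /= lee_fin s0 leey.
have mE w : (fine (mine (tau w) s%:E))%:E = mine (tau w) s%:E.
  rewrite fineK// fin_numE; apply/andP; split.
    by rewrite -ltNye lt_min ltNyr andbT (lt_le_trans _ (tau0 w))// ltNyr.
  by rewrite -ltey gt_min ltry orbT.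
pose phi w : R * Omega := (fine (mine (tau w) s%:E), w).
pose D : set (R * Omega) := `[0, s] `*` setT.
have phiD w : D (phi w).
  split=> //=; rewrite in_itv /= -!lee_fin mE ge_min lexx orbT andbT.
  by rewrite le_min tau0 lee_fin.
have phiX := hX s s0 B mB.
(* The sets with [phi]-preimage in F_s form a sigma-algebra on D; it suffices that it contains the
   measurable rectangles. *)
have sub : <<s D,
    [set E | exists C H, [/\ measurable C, C `<=` `[0, s], F s%:E H
                          & E = C `*` H]] >> `<=` [set E | F s%:E (phi @^-1` E)].
  apply: smallest_sub.
    split=> [|E FE|E FE] /=; first by rewrite preimage_set0; case: (Fs _ Js).
      rewrite (_ : _ @^-1` _ = ~` (phi @^-1` E)).
        exact: (sigma_algebra_setC (Fs _ Js)).
      by apply/seteqP; split=> w => [[]|].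
    by rewrite preimage_bigcup; case: (Fs _ Js) => _ _; exact.
  move=> _ [C [H [mC _ FH ->]]] /=.
  rewrite (_ : _ @^-1` _ = [set w | C (fine (mine (tau w) s%:E))] `&` H) //.
  apply: (sigma_algebra_setI (Fs _ Js)) => //.
  exact: (measurable_stopped s0 hF Ftau tau0 mC).
have := sigma_algebra_setI (Fs _ Js) (sub _ phiX) (Ftau _ Js).
congr (F _ _); apply/seteqP; split=> w /=.
  by move=> [[_]]; rewrite mE => + taus; rewrite min_l.
by move=> [taus Bw]; split=> //; split; [case: (phiD w)|rewrite mE min_l].
Qed.

(** Progressive measurability speaks only of real times. At +oo, the event is split into the pieces
    {tau <= n} and the piece {tau = +oo}, where the last element takes over. *)
Lemma progressive_past F (X : \bar R -> Omega -> R) tau :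
  filtration (timeT +oo%E) F -> stopping_time (timeT +oo%E) F tau ->
  (forall w, 0 <= tau w)%E -> progressively_measurable F X ->
  (forall B : set R, measurable B -> F +oo%E (X +oo%E @^-1` B)) ->
  forall B : set R, measurable B ->
  past +oo%E F tau [set w | B (X (tau w) w)].
Proof.
move=> hF Ftau tau0 hX hXy B mB; have [Fs Fm] := hF.
have Jy : timeT +oo%E (+oo%E : \bar R) by rewrite /timeT /= le0y lexx.
have FX s : timeT +oo%E s ->
    F s [set w | (tau w <= s)%E /\ B (X (tau w) w)].
  move: s => [s||] Js; [|clear Js|by move: Js => /andP[]].
    apply: (progressive_stopped _ hF Ftau tau0 hX mB).
    by move: Js => /andP[]; rewrite lee_fin.
  have -> : [set w | (tau w <= +oo)%E /\ B (X (tau w) w)] =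
      (\bigcup_(n : nat) [set w | (tau w <= n%:R%:E)%E /\ B (X (tau w) w)]) `|`
      ([set w | (+oo <= tau w)%E] `&` X +oo%E @^-1` B).
    apply/seteqP; split=> w /=.
      move=> [_ Bw]; have [ty|ty] := eqVneq (tau w) +oo%E.
        by right; rewrite -ty.
      left; have tfin : tau w \is a fin_num.
        by rewrite ge0_fin_numE ?ltey// tau0.
      exists (Num.bound (fine (tau w))) => //=; split=> //.
      rewrite -[leLHS]fineK// lee_fin ltW// archi_boundP//.
      exact/fine_ge0.
    move=> [[n _ [_ ?]]|[]]; first by split=> //; exact: leey.
    by rewrite leye_eq => /eqP -> ?; split.
  apply: (sigma_algebra_setU (Fs _ Jy)); last first.
    apply: (sigma_algebra_setI (Fs _ Jy)); last exact: hXy.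
    exact: stopping_time_ge Jy.
  case: (Fs _ Jy) => _ _; apply=> n.
  have Jn : timeT +oo%E (n%:R%:E : \bar R) by rewrite /timeT /= lee_fin ler0n leey.
  by apply: (Fm _ _ Jn Jy (leey _)); exact: (progressive_stopped (ler0n _ n) hF Ftau tau0 hX mB).
split=> [|s Js].
  have := FX _ Jy; congr (F _ _); apply/seteqP; split=> w //=; first by case.
  by split=> //; exact: leey.
by rewrite setIC; exact: FX.
Qed.

End StoppingTimes.

(** * The generalised inverse of the delays and its past *)

Section InverseDelay.
Context {R : realType} {Omega : pointedType} {I : choiceType}.

(** The existential over A expresses that t is at most the maximum of the delays, without forming
    that maximum. *)
Definition inverse_delay (T : \bar R) (p : I -> \bar R -> Omega -> \bar R)
    (A : {fset I}) (t : \bar R) (w : Omega) : \bar R :=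
  ereal_inf [set u | timeT T u /\ exists2 a, a \in A & (t <= p a u w)%E].

Variables (T : \bar R) (p : I -> \bar R -> Omega -> \bar R) (A : {fset I}).
Hypothesis T0 : (0 <= T)%E.
Hypothesis A0 : exists a, a \in A.
Hypothesis p_cont : forall a, a \in A -> continuous_delay T (p a).
Hypothesis p_ge : forall a t w, a \in A -> timeT T t -> (t <= p a t w)%E.
Hypothesis p_mono : forall a t u w, a \in A -> timeT T t -> timeT T u ->
  (t <= u)%E -> (p a t w <= p a u w)%E.
Implicit Types (t u s : \bar R) (w : Omega).

Local Notation delta := (inverse_delay T p A).

Lemma timeT_l : timeT T 0%E. Proof. by rewrite /timeT /= lexx. Qed.

Lemma timeT_r : timeT T T. Proof. by rewrite /timeT /= lexx T0. Qed.

(** Each path alone stays below s up to some rational beyond u; by monotonicity the smallest of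
    these finitely many rationals serves all paths. *)
Lemma delays_lt_right u s w : timeT T u -> (u < T)%E ->
  (forall a, a \in A -> (p a u w < s)%E) ->
  exists2 q : rat, (u < (ratr q)%:E < T)%E &
    forall a, a \in A -> (p a (ratr q)%:E w < s)%E.
Proof.
move=> Tu uT pus; have /andP[u0 _] := Tu.
have inT (q : rat) : (u < (ratr q)%:E < T)%E -> timeT T (ratr q)%:E.
  by move=> /andP[uq qT]; rewrite /timeT /= ltW ?(le_lt_trans u0)// ltW.
(* Generalised to lists of elements of A, to allow induction. *)
suff H (l : seq I) : {subset l <= A} ->
    exists2 q : rat, (u < (ratr q)%:E < T)%E &
    forall a, a \in l -> (p a (ratr q)%:E w < s)%E.
  exact: H.
elim: l => [_|b l IH lA]; first by have [q] := rat_between_ereal uT; exists q.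
have [|q uqT pq] := IH; first by move=> a al; apply: lA; rewrite inE al orbT.
have bA : b \in A by apply: lA; rewrite inE eqxx.
have [r urT pr] := continuous_lt_right (@p_cont _ bA w) Tu uT (pus _ bA).
exists (Order.min q r); first by case: (leP q r).
have le_min_q : ((ratr (Order.min q r))%:E <= (ratr q)%:E :> \bar R)%E.
  by rewrite lee_fin ler_rat ge_min lexx.
have le_min_r : ((ratr (Order.min q r))%:E <= (ratr r)%:E :> \bar R)%E.
  by rewrite lee_fin ler_rat ge_min lexx orbT.
have Tm : timeT T (ratr (Order.min q r))%:E by apply: inT; case: (leP q r).
move=> a; rewrite inE => /predU1P[->|al].
  by apply: le_lt_trans pr; apply: p_mono => //; exact: inT.
apply: le_lt_trans (pq _ al); apply: p_mono => //; last exact: inT.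
by apply: lA; rewrite inE al orbT.
Qed.

Lemma inverse_delay_ge0 t w : (0 <= delta t w)%E.
Proof. by apply: le_ereal_inf_tmp => u [/andP[]]. Qed.

Lemma inverse_delay_le t u w a : timeT T u -> a \in A -> (t <= p a u w)%E ->
  (delta t w <= u)%E.
Proof. by move=> Tu aA tp; apply: ereal_inf_lbound; split=> //; exists a. Qed.

Lemma inverse_delay_le_id t w : timeT T t -> (delta t w <= t)%E.
Proof.
by move=> Tt; have [a aA] := A0; apply: (inverse_delay_le Tt aA); exact: p_ge.
Qed.

Lemma inverse_delay_nondecreasing t s w : (t <= s)%E -> (delta t w <= delta s w)%E.
Proof.
move=> ts; apply: le_ereal_inf => u [Tu [a aA sp]]; split=> //; exists a => //.
exact: le_trans sp.
Qed.

(** The infimum is attained: if all paths are below t at u, they remain so up to some q > u, and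
    monotonicity then forces the infimum to be at least q. *)
Lemma inverse_delay_leP t u w : timeT T t -> timeT T u ->
  (delta t w <= u)%E <-> exists2 a, a \in A & (t <= p a u w)%E.
Proof.
move=> Tt Tu; split=> [du|[a aA]]; last exact: inverse_delay_le.
apply: contrapT => npt.
have put a : a \in A -> (p a u w < t)%E.
  by move=> aA; rewrite ltNge; apply/negP => tp; apply: npt; exists a.
have /andP[_ tT] := Tt; have /andP[u0 uT] := Tu.
(* At u = T the paths are at least T, hence at least t. *)
have ltuT : (u < T)%E.
  rewrite lt_neqAle uT andbT; apply/eqP => uE; have [a aA] := A0.
  have := lt_le_trans (put a aA) (le_trans tT _); rewrite uE.
  by move=> /(_ _ (p_ge w aA timeT_r)); rewrite ltxx.
have [q /andP[uq qT] pq] := delays_lt_right Tu ltuT put.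
have Tq : timeT T (ratr q)%:E by rewrite /timeT /= (le_trans u0 (ltW uq)) ltW.
suff : ((ratr q)%:E <= delta t w)%E by rewrite leNgt (le_lt_trans du uq).
apply: le_ereal_inf_tmp => v [Tv [a aA tp]]; rewrite leNgt; apply/negP => vq.
have := lt_le_trans (le_lt_trans (p_mono w aA Tv Tq (ltW vq)) (pq a aA)) tp.
by rewrite ltxx.
Qed.

(* Since [p] is continuous, the maximum over [A] of the paths [p a] takes a value
   in [t, s]; only countably many times are needed to realise one. *)
Lemma delays_hit t s w : timeT T t -> (t < s)%E ->
  (forall a, a \in A -> (p a 0%E w <= s)%E) ->
  exists2 u, timeT T u /\ [\/ u = 0%E, u = T | exists q : rat, u = (ratr q)%:E] &
    (exists2 a, a \in A & (t <= p a u w)%E) /\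
    (forall a, a \in A -> (p a u w <= s)%E).
Proof.
move=> Tt ts p0s; have /andP[_ tT] := Tt.
have d0 := inverse_delay_ge0 t w; have dt := inverse_delay_le_id w Tt.
have dT := le_trans dt tT.
have Td : timeT T (delta t w) by rewrite /timeT /= d0.
have dp := (inverse_delay_leP w Tt Td).1 (lexx _).
have [dE|d_neq0] := eqVneq (delta t w) 0%E.
  exists 0%E; first by split; [exact: timeT_l|constructor 1].
  by split=> //; rewrite -dE.
have d_gt0 : (0 < delta t w)%E by rewrite lt_def d_neq0.
(* Before the infimum every path is below t, so by left-continuity none exceeds t at the infimum;
   this needs the infimum to be positive. *)
have pdt a : a \in A -> (p a (delta t w) w <= t)%E.
  move=> aA; rewrite leNgt; apply/negP => tp.
  have [q /andP[q0 qd] tq] := continuous_gt_left (@p_cont _ aA w) Td d_gt0 tp.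
  have Tq : timeT T (ratr q)%:E.
    by rewrite /timeT /= ltW //= (le_trans (ltW qd)).
  by have := inverse_delay_le Tq aA (ltW tq); rewrite leNgt qd.
have [dE|d_neqT] := eqVneq (delta t w) T.
  exists T; first by split; [exact: timeT_r|constructor 2].
  by rewrite -dE; split=> // a aA; rewrite (le_trans (pdt _ aA)) ?ltW.
have d_ltT : (delta t w < T)%E by rewrite lt_neqAle d_neqT.
have [|q /andP[dq qT] pq] := delays_lt_right (s := s) (w := w) Td d_ltT.
  by move=> a aA; rewrite (le_lt_trans (pdt _ aA)).
have Tq : timeT T (ratr q)%:E by rewrite /timeT /= (le_trans d0 (ltW dq)) ltW.
exists (ratr q)%:E; first by split=> //; constructor 3; exists q.
split; last by move=> a aA; rewrite ltW ?pq.
have [a aA tp] := dp; exists a => //; rewrite (le_trans tp)//.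
by apply: p_mono => //; exact: ltW.
Qed.

Variable F : {fset I} -> \bar R -> set (set Omega).
Hypothesis F_filtration : filtration (timeT +oo%E) (F A).
Hypothesis p_stop : forall a t, a \in A -> timeT T t ->
  stopping_time (timeT +oo%E) (F A) (p a t).

Local Notation execF := (execution_filtration F p A).

Lemma timeT_subset t : timeT T t -> timeT +oo%E t.
Proof. by move=> /andP[t0 _]; rewrite /timeT /= t0 leey. Qed.

Lemma delay_ge0 a t w : a \in A -> timeT T t -> (0 <= p a t w)%E.
Proof.
by move=> aA Tt; have /andP[t0 _] := Tt; exact: le_trans (p_ge w aA Tt).
Qed.

Lemma past_execution a t : a \in A -> past +oo%E (F A) (p a t) `<=` execF t.
Proof. by move=> aA B pB; apply: sub_sigma_algebra; exists a. Qed.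

Lemma execution_filtration_filtration : filtration (timeT T) execF.
Proof.
split=> [t _|s t Ts Tt st]; first exact: smallest_sigma_algebra.
apply: sub_sigma_algebra2 => B [a /= aA pB]; exists a => //=.
apply: past_le pB => //; first exact: p_stop.
by move=> w; exact: p_mono.
Qed.

Lemma execution_ge t u B : timeT T t -> timeT T u -> F A t B ->
  execF u (B `&` [set w | exists2 a, a \in A & (t <= p a u w)%E]).
Proof.
move=> Tt Tu FB.
have -> : B `&` [set w | exists2 a, a \in A & (t <= p a u w)%E] =
    \bigcup_(a in [set` A]) (B `&` [set w | (t <= p a u w)%E]).
  apply/seteqP; split=> w /=; first by move=> [Bw [a aA tp]]; exists a.
  by move=> [a /= aA [Bw tp]]; split=> //; exists a.
apply: sigma_algebra_bigcup_fset => [|a aA]; first exact: smallest_sigma_algebra.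
apply: (past_execution aA); apply: past_ge => //; first exact: p_stop.
- by move=> w; exact: delay_ge0.
- exact: timeT_subset.
Qed.

(** The maximum m of the delays at u is a stopping time above each of them, so its past contains
    every generator of [execF u]. *)
Lemma execution_past_max u s B : timeT T u -> timeT +oo%E s -> execF u B ->
  F A s (B `&` [set w | forall a, a \in A -> (p a u w <= s)%E]).
Proof.
move=> Tu Js eB; have [Fs _] := F_filtration.
pose m w := ereal_sup [set p a u w | a in [set` A]].
have mE s' : [set w | (m w <= s')%E] =
    [set w | forall a, a \in A -> (p a u w <= s')%E].
  apply/seteqP; split=> w /=.
    by move=> ms a aA; apply: le_trans ms; apply: ereal_sup_ubound; exists a.
  by move=> ps; apply: ge_ereal_sup => _ [a aA <-]; exact: ps.
have m_stop : stopping_time (timeT +oo%E) (F A) m.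
  move=> s' Js'; rewrite mE.
  have -> : [set w | forall a, a \in A -> (p a u w <= s')%E] =
      ~` \bigcup_(a in [set` A]) ~` [set w | (p a u w <= s')%E].
    by rewrite setC_bigcup; apply/seteqP; split=> w /= H a aA;
      have := H a aA; rewrite setCK.
  apply: (sigma_algebra_setC (Fs _ Js')).
  apply: (sigma_algebra_bigcup_fset (Fs _ Js')) => a aA.
  by apply: (sigma_algebra_setC (Fs _ Js')); exact: p_stop.
suff : past +oo%E (F A) m B by rewrite -mE => -[_]; exact.
move: B eB; apply: smallest_sub; first exact: past_sigma_algebra.
move=> B [a /= aA]; apply: past_le => // w.
by apply: ereal_sup_ubound; exists a.
Qed.

Lemma inverse_delay_stopping_time t : timeT T t ->
  stopping_time (timeT T) execF (delta t).
Proof.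
move=> Tt u Tu.
rewrite (_ : [set w | _] =
    setT `&` [set w | exists2 a, a \in A & (t <= p a u w)%E]).
  apply: execution_ge => //; apply: sigma_algebra_setT.
  exact: F_filtration.1 (timeT_subset Tt).
by rewrite setTI; apply/seteqP; split=> w /inverse_delay_leP; exact.
Qed.

Hypothesis F_rc : right_continuous_filtration (F A).
(** An information delay vanishes at time 0, so the sought representation at t = 0 itself forces
    this inclusion. *)
Hypothesis exec0 : execF 0%E `<=` F A 0%E.

Lemma past_inverse_delay_subset t : timeT T t ->
  past T execF (delta t) `<=` F A t.
Proof.
move=> Tt B [BT Bd]; have [Fs Fm] := F_filtration; have /andP[t0 tT] := Tt.
have Jt := timeT_subset Tt.
(* Right-continuity covers finite times only. When t = +oo, the bound of the maximal delay at T by t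
   is vacuous. *)
have [ty|tNy] := eqVneq t +oo%E.
  have := execution_past_max timeT_r Jt BT; congr (F A _ _).
  by apply/seteqP; split=> w; [case|split=> // a _; rewrite ty leey].
rewrite F_rc ?/time_fin /= ?t0 ?ltey// => s /andP[ts sy].
have s0 : (0 <= s)%E by exact: le_trans (ltW ts).
have Js : timeT +oo%E s by rewrite /timeT /= s0 ltW.
have J0 : timeT +oo%E (0 : \bar R)%E by rewrite /timeT /= lexx leey.
have BdE u : timeT T u -> B `&` [set w | (delta t w <= u)%E] =
    B `&` [set w | exists2 a, a \in A & (t <= p a u w)%E].
  by move=> Tu; congr (_ `&` _); apply/seteqP; split=> w /inverse_delay_leP; exact.
pose C u := B `&` [set w | exists2 a, a \in A & (t <= p a u w)%E] `&`
  [set w | forall a, a \in A -> (p a u w <= s)%E].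
have FC u : timeT T u -> F A s (C u).
  move=> Tu; rewrite /C -BdE//; apply: execution_past_max => //; exact: Bd.
pose N := [set w | forall a, a \in A -> (p a 0%E w <= s)%E].
have FN : F A s N.
  rewrite -(setTI N); apply: (execution_past_max timeT_l Js).
  by apply: sigma_algebra_setT; exact: smallest_sigma_algebra.
(* Here the event is {delta <= 0}, so its trace on B lies in [execF 0], which [exec0] places in
   F_0. *)
have F0 : F A s (B `&` [set w | exists2 a, a \in A & (t <= p a 0%E w)%E]).
  apply: (Fm _ _ J0 Js s0); apply: exec0; rewrite -(BdE _ timeT_l).
  by apply: Bd; exact: timeT_l.
(* Rationals outside [0, T] contribute the empty set, so the union can run over all of them. *)
pose Q (q : rat) := if `[< timeT T (ratr q)%:E >] then C (ratr q)%:E else set0.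
(* On N, [delays_hit] supplies the time; off N some delay at 0 exceeds s, hence t. *)
have -> : B = (C 0%E `|` C T `|` \bigcup_q Q q) `|`
    ((B `&` [set w | exists2 a, a \in A & (t <= p a 0%E w)%E]) `&` ~` N).
  apply/seteqP; split=> [w Bw|w].
    have [Nw|Nw] := pselect (N w); [left|right].
      have [u [Tu uE] [tp ps]] := delays_hit Tt ts Nw.
      case: uE => [uE|uE|[q uE]]; first by left; left; rewrite -uE.
        by left; right; rewrite -uE.
      right; exists q => //; by rewrite /Q -uE; case: asboolP.
    split=> //; split=> //; apply: contrapT => npt; apply: Nw => a aA.
    rewrite leNgt; apply/negP => sp; apply: npt; exists a => //.
    exact/ltW/(lt_trans ts).
  case=> [[[|]|[q _]]|]; [by case=> -[]|by case=> -[]| |by case=> -[]].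
  by rewrite /Q; case: asboolP => // _ [[]].
have := Fs _ Js => Fss.
apply: (sigma_algebra_setU Fss); last first.
  by apply: (sigma_algebra_setI Fss) => //; exact: (sigma_algebra_setC Fss).
apply: (sigma_algebra_setU Fss).
  by apply: (sigma_algebra_setU Fss); apply: FC; [exact: timeT_l|exact: timeT_r].
apply: (sigma_algebra_bigcup_rat Fss) => q; rewrite /Q.
by case: asboolP => [Tq|_]; [exact: FC|case: Fss].
Qed.

Lemma past_inverse_delay t : timeT T t -> past T execF (delta t) = F A t.
Proof.
move=> Tt; apply/seteqP; split; first exact: past_inverse_delay_subset.
move=> B FB; split=> [|u Tu].
  (* Membership at the horizon holds through any single a, as p^a(T) >= T >= t. *)
  have [a aA] := A0; apply: (past_execution aA).
  apply: (past_initial _ _ (timeT_subset Tt)) => //.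
    by apply: p_stop => //; exact: timeT_r.
  move=> w; have /andP[_ tT] := Tt; apply: le_trans tT _.
  by apply: p_ge => //; exact: timeT_r.
have := execution_ge Tt Tu FB; congr (execF _ _); congr (_ `&` _).
by apply/seteqP; split=> w /inverse_delay_leP; exact.
Qed.

End InverseDelay.

(** * The two markets and the representation *)

Theorem theorem7 (R : realType) (d : measure_display) (Omega : measurableType d)
    (P : probability Omega R) (T : \bar R) (hT : (0 < T)%E)
    (G : \bar R -> set (set Omega))
    (hG : filtration (timeT +oo%E) G) (hGoo : G +oo%E = measurable)
    (I : choiceType)
    (S : I -> \bar R -> Omega -> R)
    (hS : forall a, adapted (timeT +oo%E) G (S a))
    (F : {fset I} -> \bar R -> set (set Omega))
    (hF : forall A, filtration (timeT +oo%E) (F A))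
    (hFG : forall A, subfiltration (timeT +oo%E) (F A) G)
    (An : nat -> set {fset I}) (hAn : index_system F An)
    (hsing : forall a, indices An [fset a]%fset)
    (hprog : forall a, progressively_measurable G (S a))
    (hlast : forall a (B : set R), measurable B -> G +oo%E (S a +oo%E @^-1` B))
    (Inf : I -> \bar R -> set (set Omega))
    (p : I -> \bar R -> Omega -> \bar R)
    (hp : forall a, order_execution_delay T G (Inf a) (p a))
    (hpc : forall a, continuous_delay T (p a))
    (hInf : forall A a, indices An A -> a \in A ->
       subfiltration time_fin (Inf a) (F A))
    (hFrc : forall A, indices An A -> right_continuous_filtration (F A))
    (h0 : forall A, indices An A -> execution_filtration F p A 0%E `<=` F A 0%E) :
  let M := Market (delayed_price S p) F (delayed_general G p) T in
  let M' := Market (delayed_price S p) (execution_filtration F p)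
              (delayed_general G p) T in
  [/\ is_market (indices An) M, is_market (indices An) M'
    & represented_via_information_delay (indices An) M M'].
Proof.
move=> M M'; have T0 := ltW hT; have [cardA _ monoA] := hAn.
have J t : timeT T t -> timeT +oo%E t by exact: timeT_subset.
have Gs t : timeT T t -> sigma_algebra setT (G t) by move=> /J; exact: hG.1.
have A0 A : indices An A -> exists a, a \in A.
  move=> [n /= n0 /(cardA _ _ n0) An_card]; apply/fset0Pn.
  by rewrite -cardfs_eq0 An_card -lt0n.
have p_cont (A : {fset I}) a : a \in A -> continuous_delay T (p a).
  by move=> _; exact: hpc.
have p_ge (A : {fset I}) a t w : a \in A -> timeT T t -> (t <= p a t w)%E.
  by move=> _; have [_ _ _ + _] := hp a; exact.
have p_mono (A : {fset I}) a t u w : a \in A -> timeT T t -> timeT T u ->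
    (t <= u)%E -> (p a t w <= p a u w)%E.
  by move=> _; have [_ _ _ _ +] := hp a; exact.
have p_ge0 a t w : timeT T t -> (0 <= p a t w)%E.
  (* The bound is stated for members of a finite set; the singleton of a provides one. *)
  exact: (delay_ge0 (p_ge [fset a]%fset)) (fset11 a).
have p_stop A (AA : indices An A) a t : a \in A -> timeT T t ->
    stopping_time (timeT +oo%E) (F A) (p a t).
  move=> aA Tt; have [_ _ + _ _] := hp a => /(_ t Tt).
  by apply: stopping_time_extend; [exact: hF|exact: hInf].
have p_stopG a t : timeT T t -> stopping_time (timeT +oo%E) G (p a t).
  move=> Tt; have [_ + + _ _] := hp a => IG /(_ t Tt).
  exact: stopping_time_extend.
have pastG a t : past +oo%E G (p a t) `<=` delayed_general G p t.
  by move=> B pB; apply: sub_sigma_algebra; exists a.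
have Gp_filtration : filtration (timeT T) (delayed_general G p).
  split=> [t _|s t Ts Tt st]; first exact: smallest_sigma_algebra.
  apply: sub_sigma_algebra2 => B [a _ pB]; exists a => //.
  apply: past_le pB => //; first exact: p_stopG.
  by move=> w; apply: (p_mono [fset a]%fset) => //; exact: fset11.
have S_adapted a : adapted (timeT T) (delayed_general G p) (delayed_price S p a).
  move=> t Tt B mB; apply: (pastG a).
  apply: (progressive_past (tau := p a t) hG) mB => //.
  - exact: p_stopG.
  - by move=> w; exact: p_ge0.
  - exact: hlast.
have exec_filtration A : indices An A ->
    filtration (timeT T) (execution_filtration F p A).
  move=> AA; apply: execution_filtration_filtration; [exact: p_mono|exact: hF|].
  exact: p_stop.
have exec_subG A : indices An A ->
    subfiltration (timeT T) (execution_filtration F p A) (delayed_general G p).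
  move=> AA t Tt; apply: sub_sigma_algebra2 => B [a _ pB]; exists a => //.
  exact: past_subfiltration pB.
have isM : is_market (indices An) M.
  split=> //=.
    move=> A _; have [Fs Fm] := hF A.
    by split=> [t /J|s t /J Js /J]; [exact: Fs|exact: Fm].
  (* Since t <= p^a(t), an event of G_t belongs to the p^a(t)-past for any a in A. *)
  move=> A AA t Tt B FB; have [a aA] := A0 _ AA; apply: (pastG a).
  apply: (past_initial hG _ (J _ Tt)); [exact: p_stopG| |exact: hFG (J _ Tt) _ FB].
  by move=> w; exact: (p_ge A).
have isM' : is_market (indices An) M' by [].
split=> //; exists (execution_filtration F p), (inverse_delay T p).
split=> [A AA|A t].
  split; last by move=> t Tt.
  split=> /=.
  - exact: exec_filtration.
  - exact: exec_subG.
  - move=> t; apply: (inverse_delay_stopping_time T0 (A0 A AA)) => //.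
    + exact: p_ge.
    + exact: p_mono.
    + exact: p_stop.
  - move=> t w Tt; rewrite inverse_delay_ge0/=.
    by apply: inverse_delay_le_id => //; [exact: A0|exact: p_ge].
  - by move=> t s w _ _; exact: inverse_delay_nondecreasing.
(* Strong induction on the cardinality, following the recursion that defines the delayed
   filtrations. *)
have [k] := ubnP #|` A|%fset; elim: k A t => // k IH A t; rewrite ltnS => Ak AA Tt.
rewrite delayed_filtrationE /= (past_inverse_delay T0 (A0 A AA) (p_cont A) (p_ge A)
  (p_mono A) (hF A) (p_stop A AA) (hFrc _ AA) (h0 _ AA))//.
have [Fs _] := hF A; apply/seteqP; split; last first.
  by move=> B FB; apply: sub_sigma_algebra; left.
apply: smallest_sub; first exact/Fs/J.
move=> B [//|[A' [AA' ltA']]]; rewrite IH//.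
  by apply: monoA => //; [exact: fproper_sub|exact: J].
exact: leq_trans (fproper_ltn_card ltA') Ak.
Qed.
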